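(* Let $G$ be a finitely presented group and let $H$ be a finitely generated normal subgroup of $G$ such that $G/H$ is infinite cyclic. Then $H$ has an ascending finite L-presentation with two free group endomorphisms; that is, there exist a finite set $X$, a finite subset $R$ of the free group $F(X)$, and a set $\Phi=\{\eta,\tau\}$ consisting of two endomorphisms $\eta,\tau$ of $F(X)$, such that $H$ is isomorphic to the group defined by the L-presentation $\langle X\mid \emptyset\mid R\mid \Phi\rangle$.
   Context: For a subset $S$ of a group, $\langle S\rangle^{\#}$ denotes the normal subgroup generated by $S$ (the normal closure of $S$). For a set $\Phi$ of endomorphisms of a group, $\Phi^*$ denotes the monoid generated by $\Phi$, i.e. the closure of $\{1\}\cup\Phi$ under composition, where $1$ is the identity map. An endomorphic presentation (or L-presentation) is an expression $\langle X\mid Q\mid R\mid \Phi\rangle$, where $X$ is a set, $Q,R$ are subsets of the free group $F(X)$ on $X$, and $\Phi$ is a set of endomorphisms of $F(X)$. It defines the group $F(X)/N$, where $N=\langle Q\cup\bigcup_{\phi\in\Phi^*}\phi(R)\rangle^{\#}$. It is called finite if $X,Q,R,\Phi$ are all finite, and ascending if $Q$ is empty. *)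

(* Defs.v *)
From HB Require Import structures.
From mathcomp Require Import all_boot.
From mathcomp Require Import generic_quotient.
From mathcomp Require Import boolp classical_sets functions cardinality.

Set Implicit Arguments.
Unset Strict Implicit.
Unset Printing Implicit Defensive.

Local Open Scope group_scope.
Local Open Scope classical_set_scope.

(* Groups are [groupType]s.  The [choiceType] structure this carries is no
   restriction in the presence of the classical axioms of [boolp].
   Homomorphisms of groups are [{multiplicative G -> H}]. *)

Section Subgroups.
Variable G : groupType.

Definition is_subgroup (A : set G) : Prop := group_closed (mem A).

Definition is_normal_subgroup (A : set G) : Prop :=
  is_subgroup A /\ (forall x g : G, A x -> A (x ^ g)).

Definition subgroup_gen (S : set G) : set G := smallest is_subgroup S.

Definition normal_closure (S : set G) : set G := smallest is_normal_subgroup S.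

Record subgroup := Subgroup {
  subgroup_set :> set G;
  subgroupP : is_subgroup subgroup_set }.

Record normalSubgroup := NormalSubgroup {
  normalSubgroup_set : set G;
  normalSubgroupP : is_normal_subgroup normalSubgroup_set }.

Definition subgroup_of_normal (N : normalSubgroup) : subgroup :=
  Subgroup (proj1 (normalSubgroupP N)).

Lemma normal_closureP (S : set G) : is_normal_subgroup (normal_closure S).
Proof.
split; first split.
- apply/mem_set => A [[[A1 _] _] _].
  exact: set_mem A1.
- move=> x y /set_mem xS /set_mem yS; apply/mem_set => A AS.
  case: (AS) => [[[_ AD] _] _]; apply/set_mem/AD; apply/mem_set.
    exact: xS.
  exact: yS.
- by move=> x g xS A AS; case: (AS) => [[_ AJ] _]; apply/AJ/(xS A AS).
Qed.

Definition normal_closure_group (S : set G) : normalSubgroup :=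
  NormalSubgroup (normal_closureP S).

End Subgroups.

Coercion subgroup_of_normal : normalSubgroup >-> subgroup.

Definition subgroup_type (G : groupType) (H : subgroup G) : Type :=
  {x : G | x \in (H : set G)}.

Coercion subgroup_type : subgroup >-> Sortclass.

HB.instance Definition _ (G : groupType) (H : subgroup G) :=
  SubChoice.on (subgroup_type H).
HB.instance Definition _ (G : groupType) (H : subgroup G) :=
  SubChoice_isSubGroup.Build G _ (subgroup_type H) (subgroupP H).

Section Quotient.
Variables (G : groupType) (N : normalSubgroup G).
Local Open Scope quotient_scope.

Definition cosetr (x y : G) : bool := `[< (N : set G) (x^-1 * y) >].

Let N1 : (N : set G) 1.
Proof. by case: (subgroupP N) => /set_mem. Qed.

Let NV x : (N : set G) x -> (N : set G) x^-1.
Proof.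
by move=> Nx; apply/set_mem/(group_closedV (subgroupP N))/mem_set.
Qed.

Let NM x y : (N : set G) x -> (N : set G) y -> (N : set G) (x * y).
Proof.
by move=> Nx Ny; apply/set_mem/(group_closedM (subgroupP N)); apply/mem_set.
Qed.

Let NJ x g : (N : set G) x -> (N : set G) (x ^ g).
Proof. exact: (proj2 (normalSubgroupP N)). Qed.

Lemma cosetr_refl : reflexive cosetr.
Proof. by move=> x; apply/asboolP; rewrite mulVg. Qed.

Lemma cosetr_sym : symmetric cosetr.
Proof.
by move=> x y; apply/asboolP/asboolP => /NV; rewrite invgM invgK.
Qed.

Lemma cosetr_trans : transitive cosetr.
Proof.
move=> y x z /asboolP xy /asboolP yz; apply/asboolP.
by have := NM xy yz; rewrite -mulgA mulVKg.
Qed.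

Canonical cosetr_equiv := EquivRel cosetr cosetr_refl cosetr_sym cosetr_trans.

Definition quotient : Type := {eq_quot cosetr}.

HB.instance Definition _ := Choice.on quotient.
HB.instance Definition _ := EqQuotient.on quotient.

Definition quot_proj (x : G) : quotient := \pi_quotient x.

Lemma quot_projP x y :
  reflect ((N : set G) (x^-1 * y)) (quot_proj x == quot_proj y).
Proof. by rewrite /quot_proj eqmodE; apply: asboolP. Qed.

Lemma quot_proj_repr (q : quotient) : quot_proj (repr q) = q.
Proof. exact: reprK. Qed.

Definition quot_one : quotient := quot_proj 1.
Definition quot_inv (p : quotient) : quotient := quot_proj (repr p)^-1.
Definition quot_mul (p q : quotient) : quotient :=
  quot_proj (repr p * repr q).

Lemma quot_projM x y : quot_proj (x * y) = quot_mul (quot_proj x) (quot_proj y).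
Proof.
rewrite /quot_mul; set x' := repr (quot_proj x); set y' := repr (quot_proj y).
have /esym/eqP/quot_projP xx' : quot_proj x' = quot_proj x := quot_proj_repr _.
have /esym/eqP/quot_projP yy' : quot_proj y' = quot_proj y := quot_proj_repr _.
apply/eqP/quot_projP; have := NM (NJ y xx') yy'.
by rewrite /conjg invgM -!mulgA mulVKg.
Qed.

Lemma quot_projV x : quot_proj x^-1 = quot_inv (quot_proj x).
Proof.
rewrite /quot_inv; set x' := repr (quot_proj x).
have /eqP/quot_projP xx' : quot_proj x' = quot_proj x := quot_proj_repr _.
apply/eqP/quot_projP; rewrite invgK.
by have := NJ x'^-1 xx'; rewrite /conjg invgK -!mulgA mulVKg.
Qed.

Lemma quot_mulA : associative quot_mul.
Proof.
move=> p q r; rewrite -(quot_proj_repr p) -(quot_proj_repr q).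
by rewrite -(quot_proj_repr r) -!quot_projM mulgA.
Qed.

Lemma quot_mul1 : left_id quot_one quot_mul.
Proof. by move=> p; rewrite -(quot_proj_repr p) -quot_projM mul1g. Qed.

Lemma quot_1mul : right_id quot_one quot_mul.
Proof. by move=> p; rewrite -(quot_proj_repr p) -quot_projM mulg1. Qed.

Lemma quot_mulV : left_inverse quot_one quot_inv quot_mul.
Proof. by move=> p; rewrite -(quot_proj_repr p) -quot_projV -quot_projM mulVg. Qed.

Lemma quot_Vmul : right_inverse quot_one quot_inv quot_mul.
Proof. by move=> p; rewrite -(quot_proj_repr p) -quot_projV -quot_projM mulgV. Qed.

HB.instance Definition _ :=
  isGroup.Build quotient quot_mulA quot_mul1 quot_1mul quot_mulV quot_Vmul.

HB.instance Definition _ := isMultiplicative.Build G quotient quot_proj quot_projM.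

Lemma quot_proj_surj (q : quotient) : exists x, quot_proj x = q.
Proof. by exists (repr q); apply: quot_proj_repr. Qed.

Lemma quot_proj_ker (x : G) : quot_proj x = 1 <-> (N : set G) x.
Proof.
by split=> [/esym/eqP/quot_projP | Nx]; first rewrite invg1 mul1g;
  last by apply/esym/eqP/quot_projP; rewrite invg1 mul1g.
Qed.

End Quotient.

(* The free group on X is the set of freely reduced words: the letter
   (x, false) stands for the generator x and (x, true) for its inverse. *)
Section FreeGroup.
Variable X : choiceType.

Definition letter_inv (a : X * bool) : X * bool := (a.1, ~~ a.2).

Definition reduced (w : seq (X * bool)) : bool :=
  sorted (fun a b => b != letter_inv a) w.

Definition free_group : Type := {w : seq (X * bool) | reduced w}.

HB.instance Definition _ := SubChoice.on free_group.

Definition rcat1 (a : X * bool) (w : seq (X * bool)) : seq (X * bool) :=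
  if w is b :: w' then if b == letter_inv a then w' else a :: w else [:: a].

(* Reduced form of u ++ v, for v reduced. *)
Definition rcat (u v : seq (X * bool)) : seq (X * bool) := foldr rcat1 v u.

Definition word_inv (u : seq (X * bool)) : seq (X * bool) :=
  rev (map letter_inv u).

Lemma letter_invK : involutive letter_inv.
Proof. by case=> x b; rewrite /letter_inv /= negbK. Qed.

Lemma rcat1_reduced a w : reduced w -> reduced (rcat1 a w).
Proof.
case: w => [|b w] //= bw; case: ifPn => [_|ba]; first exact: path_sorted bw.
by rewrite /= ba.
Qed.

Lemma rcat_reduced u v : reduced v -> reduced (rcat u v).
Proof. by move=> rv; elim: u => //= a u; apply: rcat1_reduced. Qed.

Lemma rcat1K a w : reduced w -> rcat1 a (rcat1 (letter_inv a) w) = w.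
Proof.
case: w => [|b w] /=; first by rewrite eqxx.
rewrite letter_invK; case: eqP => [->|_ _] /=; last by rewrite eqxx.
by case: w => [|c w] //= /andP[/negPf->].
Qed.

Lemma rcat_cat u v w : rcat (u ++ v) w = rcat u (rcat v w).
Proof. exact: foldr_cat. Qed.

Lemma rcat_rcat1 a u w : reduced w ->
  rcat (rcat1 a u) w = rcat1 a (rcat u w).
Proof.
move=> rw; case: u => [|b u] //=; case: eqP => [->|] //=.
by rewrite rcat1K // rcat_reduced.
Qed.

Lemma rcatA u v w : reduced w -> rcat u (rcat v w) = rcat (rcat u v) w.
Proof. by move=> rw; elim: u => //= a u ->; rewrite rcat_rcat1. Qed.

Lemma rcats0 u : reduced u -> rcat u [::] = u.
Proof.
elim: u => //= a u IHu ru; rewrite (IHu (path_sorted ru)).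
by case: u ru {IHu} => //= b u /andP[/negPf->].
Qed.

Lemma word_inv_reduced u : reduced u -> reduced (word_inv u).
Proof.
rewrite /word_inv /reduced rev_sorted sorted_map; apply: sub_sorted => a b /=.
by apply: contra => /eqP/(can_inj letter_invK) ->; rewrite letter_invK.
Qed.

Lemma rcat_inv u w : reduced w -> rcat (word_inv u) (rcat u w) = w.
Proof.
move=> rw; elim: u => //= a u IHu.
rewrite /word_inv /= rev_cons -cats1 rcat_cat /= -[in rcat1 a _](letter_invK a).
by rewrite rcat1K ?rcat_reduced.
Qed.

Lemma word_invK : involutive word_inv.
Proof. by move=> u; rewrite /word_inv map_rev revK (mapK letter_invK). Qed.

Definition fg_one : free_group := Sub [::] isT.
Definition fg_inv (u : free_group) : free_group :=
  Sub _ (word_inv_reduced (valP u)).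
Definition fg_mul (u v : free_group) : free_group :=
  Sub _ (rcat_reduced (val u) (valP v)).

Lemma fg_mulA : associative fg_mul.
Proof. by move=> u v w; apply/val_inj/rcatA/(valP w). Qed.

Lemma fg_mul1 : left_id fg_one fg_mul.
Proof. by move=> u; apply/val_inj. Qed.

Lemma fg_1mul : right_id fg_one fg_mul.
Proof. by move=> u; apply/val_inj/rcats0/(valP u). Qed.

Lemma fg_mulV : left_inverse fg_one fg_inv fg_mul.
Proof.
move=> u; apply/val_inj => /=.
by rewrite -[X in rcat _ X](rcats0 (valP u)) rcat_inv.
Qed.

Lemma fg_Vmul : right_inverse fg_one fg_inv fg_mul.
Proof.
move=> u; have uVV : fg_inv (fg_inv u) = u by apply/val_inj/word_invK.
by rewrite -[X in fg_mul X _]uVV fg_mulV.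
Qed.

HB.instance Definition _ :=
  isGroup.Build free_group fg_mulA fg_mul1 fg_1mul fg_mulV fg_Vmul.

Definition fg_gen (x : X) : free_group := Sub [:: (x, false)] isT.

Section UniversalProperty.
Variables (G : groupType) (f : X -> G).

Definition letter_val (a : X * bool) : G := if a.2 then (f a.1)^-1 else f a.1.

Definition fg_lift (u : free_group) : G := \prod_(a <- val u) letter_val a.

Lemma fg_lift_mul : {morph fg_lift : u v / u * v}.
Proof.
have letter_valV a : letter_val (letter_inv a) = (letter_val a)^-1.
  by rewrite /letter_val; case: a => x [] /=; rewrite ?invgK.
have rcat1_val a (w : seq (X * bool)) :
    \prod_(b <- rcat1 a w) letter_val b = letter_val a * \prod_(b <- w) letter_val b.
  case: w => [|b w] /=; first by rewrite big_cons.
  by case: eqP => [->|_]; rewrite !big_cons // letter_valV mulVKg.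
move=> [u ru] [v rv]; rewrite /fg_lift /=.
by elim: u {ru} => [|a u IHu] /=; rewrite ?big_nil ?mul1g // rcat1_val IHu big_cons mulgA.
Qed.

HB.instance Definition _ :=
  isMultiplicative.Build free_group G fg_lift fg_lift_mul.

Lemma fg_lift_gen x : fg_lift (fg_gen x) = f x.
Proof. by rewrite /fg_lift big_seq1. Qed.

Lemma fg_lift_unique (h : {multiplicative free_group -> G}) :
  (forall x, h (fg_gen x) = f x) -> h =1 fg_lift.
Proof.
move=> hf.
have h1 : h 1 = 1 by apply: (mulgI (h 1)); rewrite -gmulfM !mulg1.
have hV u : h u^-1 = (h u)^-1.
  by apply: (mulgI (h u)); rewrite -gmulfM !mulgV h1.
case=> u ru; rewrite /fg_lift /=; elim: u ru => [|[x b] u IHu] ru.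
  by rewrite big_nil -h1; congr (h _); apply/val_inj.
have ru' : reduced u := path_sorted ru.
rewrite big_cons -(IHu ru').
pose a : free_group := if b then (fg_gen x)^-1 else fg_gen x.
have -> : letter_val (x, b) = h a by rewrite /a /letter_val; case: b {ru a} => /=; rewrite ?hV hf.
rewrite -gmulfM; congr (h _); apply/val_inj; rewrite /a /=.
have /= := rcats0 ru; rewrite rcats0 // => {1}<-.
by case: b {ru a}.
Qed.

End UniversalProperty.
End FreeGroup.

Definition isomorphic (G H : groupType) : Prop :=
  exists f : {multiplicative G -> H}, bijective f.

Definition finitely_generated (G : groupType) : Prop :=
  exists2 S : set G, finite_set S & subgroup_gen S = [set: G].

Definition infinite_cyclic (G : groupType) : Prop :=
  (exists x : G, subgroup_gen [set x] = [set: G]) /\ infinite_set [set: G].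

Definition finitely_presented (G : groupType) : Prop :=
  exists (X : finType) (R : set (free_group X)),
    finite_set R /\ isomorphic G (quotient (normal_closure_group R)).

Definition is_endo_monoid (G : groupType)
    (M : set {multiplicative G -> G}) : Prop :=
  M idfun /\ (forall phi psi, M phi -> M psi -> M (phi \o psi)).

Definition endo_monoid (G : groupType) (Phi : set {multiplicative G -> G}) :
    set {multiplicative G -> G} :=
  smallest (@is_endo_monoid G) Phi.

Definition lpres_relators (X : choiceType) (Q R : set (free_group X))
    (Phi : set {multiplicative free_group X -> free_group X}) :
    set (free_group X) :=
  Q `|` \bigcup_(phi in endo_monoid Phi) (phi @` R).

Definition lpres_group (X : choiceType) (Q R : set (free_group X))
    (Phi : set {multiplicative free_group X -> free_group X}) : groupType :=
  quotient (normal_closure_group (lpres_relators Q R Phi)).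

(* Main.v *)
Require Import Defs.
From HB Require Import structures.
From mathcomp Require Import all_boot ssralg ssrint intdiv.
From mathcomp Require Import boolp classical_sets functions cardinality.

(** The group [H] is the image of a free group [F(X)] of finite rank, and [G/H]
    is generated by the class of some [t] of infinite order modulo [H].  Since
    [H] is normal, the conjugations [h |-> h ^ t^-1] and [h |-> h ^ t] of [H]
    lift to endomorphisms [eta] and [tau] of the free group [F(X)].

    Take first only the relators [x^-1 * eta (tau x)] and [x^-1 * tau (eta x)],
    [x] in [X].  Closing them under [eta] and [tau] gives a group [K] on which
    [eta] and [tau] induce mutually inverse automorphisms, so that the
    semidirect product [E] of [K] with the integers exists.  It maps onto [G],
    by [K -> H] and [1 |-> t].  The group [E] is finitely generated and [G] is
    finitely presented, so the kernel of [E -> G] is the normal closure of a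
    finite set [W] ([finitely_normally_generated_kernel]).  As [t] has infinite
    order modulo [H], this kernel lies in [K], and each element of [W] is
    represented by a word in [F(X)]; let [R] consist of these words together
    with the relators chosen first.

    Then [<X | empty | R | {eta, tau}>] presents [H].  Its relators die in [H]
    because [eta] and [tau] preserve the kernel of [F(X) -> H].  Conversely, a
    word that dies in [H] represents an element of [E] in the normal closure of
    [W].  The consequences of the presentation have an image in [K] that
    contains [W]; being stable under [eta] and [tau], this image is normal not
    just in [K] but in [E], so it contains the given element
    ([ker_ascending_presentation]). *)

Set Implicit Arguments.
Unset Strict Implicit.
Unset Printing Implicit Defensive.

Local Open Scope group_scope.
Local Open Scope classical_set_scope.

(** * Subgroups, generation and homomorphisms *)

Section Subgroups.
Variable G : groupType.
Implicit Types (A S : set G).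

Lemma is_subgroupI A :
  A 1 -> (forall x y, A x -> A y -> A (x / y)) -> is_subgroup A.
Proof.
by move=> A1 AF; split=> [|x y /set_mem Ax /set_mem Ay]; apply/mem_set; auto.
Qed.

Lemma subgroup1 A : is_subgroup A -> A 1.
Proof. by case=> /set_mem. Qed.

Lemma subgroupM A x y : is_subgroup A -> A x -> A y -> A (x * y).
Proof.
by move=> sA Ax Ay; apply/set_mem/(group_closedM sA); apply/mem_set.
Qed.

Lemma subgroupV A x : is_subgroup A -> A x -> A x^-1.
Proof. by move=> sA Ax; apply/set_mem/(group_closedV sA)/mem_set. Qed.

Lemma subgroupF A x y : is_subgroup A -> A x -> A y -> A (x / y).
Proof. by move=> sA Ax Ay; apply: subgroupM => //; apply: subgroupV. Qed.

Lemma subgroup_genP S : is_subgroup (subgroup_gen S).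
Proof.
apply: is_subgroupI => [A [/subgroup1] // | x y Sx Sy A AS].
by apply: subgroupF; [exact: AS.1 | exact: Sx | exact: Sy].
Qed.

Lemma gen_ind S A : subgroup_gen S = setT -> is_subgroup A -> S `<=` A ->
  forall x, A x.
Proof.
move=> genS sA SA x; have : [set: G] x by [].
by rewrite -genS => /(smallest_sub sA SA).
Qed.

End Subgroups.

Section Homomorphisms.
Variables (G H : groupType) (f : {multiplicative G -> H}).

Lemma homg1 : f 1 = 1.
Proof. by apply: (mulgI (f 1)); rewrite -gmulfM !mulg1. Qed.

Lemma homgV x : f x^-1 = (f x)^-1.
Proof. by apply: (mulgI (f x)); rewrite -gmulfM !mulgV homg1. Qed.

Lemma homgF x y : f (x / y) = f x / f y.
Proof. by rewrite gmulfM homgV. Qed.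

Lemma homgJ x y : f (x ^ y) = f x ^ f y.
Proof. by rewrite !conjgE !gmulfM homgV. Qed.

Lemma is_subgroup_preimage (B : set H) :
  is_subgroup B -> is_subgroup (f @^-1` B).
Proof.
move=> sB; apply: is_subgroupI => [|x y] /=.
  by rewrite homg1; apply: subgroup1.
by rewrite homgF; apply: subgroupF.
Qed.

Lemma is_normal_preimage (B : set H) :
  is_normal_subgroup B -> is_normal_subgroup (f @^-1` B).
Proof.
case=> sB nB; split; first exact: is_subgroup_preimage.
by move=> x g /= Bx; rewrite homgJ; apply: nB.
Qed.

Lemma is_normal_ker : is_normal_subgroup [set x | f x = 1].
Proof.
split; last by move=> x g /= fx; rewrite homgJ fx conj1g.
apply: is_subgroupI => [|x y /= fx fy]; rewrite /= ?homg1 //.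
by rewrite homgF fx fy mulgV.
Qed.

End Homomorphisms.

Lemma hom_ext (G H : groupType) (f g : {multiplicative G -> H}) (S : set G) :
  subgroup_gen S = setT -> (forall x, S x -> f x = g x) -> f =1 g.
Proof.
move=> genS fg; apply: (gen_ind genS) => //.
by apply: is_subgroupI => [|x y fx fy]; rewrite /= ?homg1 // !homgF fx fy.
Qed.

Lemma free_gen (X : choiceType) : subgroup_gen (range (@fg_gen X)) = setT.
Proof.
pose word u (ru : reduced u) : free_group X := exist _ u ru.
rewrite -subTset => -[u ru] _; rewrite -[exist _ u ru]/(word u ru).
elim: u ru => [|[x b] u IHu] ru.
  have -> : word _ ru = 1 by exact/val_inj.
  exact: subgroup1 (subgroup_genP _).
have ru' : reduced u := path_sorted ru.
have -> : word _ ru = (if b then (fg_gen x)^-1 else fg_gen x) * word _ ru'.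
  apply/val_inj; have /= := rcats0 ru; rewrite rcats0 // => {1}<-.
  by case: b {ru}.
apply: (subgroupM (subgroup_genP _)); last exact: IHu.
have Sx : subgroup_gen (range (@fg_gen X)) (fg_gen x).
  by apply: sub_gen_smallest; exists x.
by case: b {ru} => //; apply: (subgroupV (subgroup_genP _)).
Qed.

(** * Quotient groups *)

Section QuotientLift.
Variables (G H : groupType) (N : normalSubgroup G).
Variable f : {multiplicative G -> H}.
Hypothesis fN : forall x, (N : set G) x -> f x = 1.

Definition quot_lift (q : quotient N) : H := f (repr q).

Lemma quot_lift_proj x : quot_lift (quot_proj N x) = f x.
Proof.
rewrite /quot_lift; set y := repr _.
have /eqP/quot_projP/fN : quot_proj N x = quot_proj N y.
  by rewrite quot_proj_repr.
by rewrite gmulfM homgV => /(canRL (mulVKg _)) ->; rewrite mulg1.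
Qed.

Lemma quot_lift_mul : {morph quot_lift : p q / p * q}.
Proof.
move=> p q; rewrite -(quot_proj_repr p) -(quot_proj_repr q).
by rewrite -gmulfM !quot_lift_proj gmulfM.
Qed.

HB.instance Definition _ :=
  isMultiplicative.Build (quotient N) H quot_lift quot_lift_mul.

Definition quot_hom : {multiplicative quotient N -> H} := quot_lift.

Lemma quot_homE x : quot_hom (quot_proj N x) = f x.
Proof. exact: quot_lift_proj. Qed.

End QuotientLift.

Lemma quot_gen (G : groupType) (N : normalSubgroup G) (S : set G) :
  subgroup_gen S = setT -> subgroup_gen (quot_proj N @` S) = setT.
Proof.
move=> genS; rewrite -subTset => q _; have [x <-] := quot_proj_surj q.
pose A := quot_proj N @^-1` subgroup_gen (quot_proj N @` S).
apply: (gen_ind (A := A) genS) => [|y Sy].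
  exact: is_subgroup_preimage (subgroup_genP _).
by apply: sub_gen_smallest; exists y.
Qed.

(** First isomorphism theorem; the isomorphism goes from the image to the
    quotient, so it is defined through a section of [f]. *)
Lemma first_isomorphism (G H : groupType) (N : normalSubgroup G)
    (f : {multiplicative G -> H}) :
  (forall y, exists x, f x = y) -> (forall x, f x = 1 <-> (N : set G) x) ->
  isomorphic H (quotient N).
Proof.
move=> /choice[s sK] kerf.
have fN x : (N : set G) x -> f x = 1 by move/kerf.
pose g y := quot_proj N (s y).
have gf x : g (f x) = quot_proj N x.
  by apply/eqP/quot_projP/kerf; rewrite gmulfM homgV sK mulVg.
have gM : {morph g : x y / x * y}.
  by move=> x y; rewrite -[in LHS](sK x) -[in LHS](sK y) -gmulfM gf gmulfM.
pose gh : {multiplicative H -> quotient N} :=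
  HB.pack g (isMultiplicative.Build _ _ g gM).
exists gh; exists (quot_hom fN) => [y|q]; first by rewrite quot_homE sK.
by have [x <-] := quot_proj_surj q; rewrite quot_homE [gh _]gf.
Qed.

(** * Finite generation and finite presentability *)

Lemma finitely_generated_cover (H : groupType) : finitely_generated H ->
  exists (X : finType) (f : {multiplicative free_group X -> H}),
    forall y, exists u, f u = y.
Proof.
move=> [S /finite_seqP[s ->] genS].
pose f : {multiplicative free_group (seq_sub s) -> H} :=
  fg_lift (fun x : seq_sub s => val x).
exists (seq_sub s), f.
pose A := [set y | exists u, f u = y].
apply: (gen_ind (A := A) genS) => [|y sy].
  apply: is_subgroupI => [|_ _ [u <-] [v <-]]; first by exists 1; exact: homg1.
  by exists (u / v); rewrite homgF.
by exists (fg_gen (SeqSub sy)); rewrite [f _]fg_lift_gen.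
Qed.

(** Free groups are projective. *)
Lemma lift_words (X : choiceType) (G H : groupType)
  (p : {multiplicative free_group X -> H}) (f : {multiplicative G -> H}) :
  (forall y, exists x, f x = y) ->
  exists s : {multiplicative free_group X -> G}, forall u, f (s u) = p u.
Proof.
move=> /choice[r rK]; exists (fg_lift (fun x => r (p (fg_gen x)))).
apply: (hom_ext (f := f \o fg_lift _) (free_gen X)) => _ [x _ <-] /=.
by rewrite fg_lift_gen rK.
Qed.

(** Let [<Y | T>] present [G] and let [s : F(Y) -> E] lift [F(Y) -> G].  Modulo
    the normal closure of [s T], the image of [s] becomes a copy of [G]; killing
    also [x^-1 * s (c x)] for each generator [x] of [E], where the word [c x]
    represents [f x], makes this image all of the quotient of [E]. *)
Lemma finitely_normally_generated_kernel (E G : groupType)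
    (f : {multiplicative E -> G}) :
  finitely_generated E -> finitely_presented G ->
  (forall y, exists x, f x = y) ->
  exists2 W : set E, finite_set W &
    forall x, f x = 1 <-> normal_closure W x.
Proof.
move=> [S finS genS] [Y [T [finT [i [j iK jK]]]]] fsurj.
pose h := (i \o f : {multiplicative E -> _}).
have i_inj : injective i := can_inj iK.
have hsurj q : exists x, h x = q.
  by have [x fx] := fsurj (j q); exists x; rewrite /= fx jK.
have hE x : f x = 1 <-> h x = 1.
  by split=> [/= ->|/= hx]; rewrite ?homg1 //; apply: i_inj; rewrite hx homg1.
have [s hs] := lift_words (quot_proj (normal_closure_group T)) hsurj.
have kerT u : h (s u) = 1 <-> normal_closure T u.
  by rewrite hs; exact: (@quot_proj_ker _ (normal_closure_group T)).
have /choice[c hc] : forall x, exists u, h x = h (s u).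
  by move=> x; have [u pu] := quot_proj_surj (h x); exists u; rewrite -pu hs.
pose W := s @` T `|` [set x^-1 * s (c x) | x in S].
have finW : finite_set W by rewrite finite_setU; split; exact: finite_image.
have WN x : W x -> normal_closure W x by apply: sub_gen_smallest.
have Wker x : normal_closure W x -> f x = 1.
  apply: (smallest_sub (is_normal_ker f)) => {x} _ [[u Tu <-]|[y Sy <-]] /=.
    apply: (hE _).2; apply: (kerT _).2; exact: sub_gen_smallest Tu.
  by apply: (hE _).2; rewrite gmulfM homgV -hc mulVg.
exists W => // x; split; last exact: Wker.
have [sW NW] := normal_closureP W.
have sT u : normal_closure T u -> normal_closure W (s u).
  apply: (smallest_sub (is_normal_preimage s (normal_closureP W))) => v Tv /=.
  by apply: WN; left; exists v.
(* Modulo [W], every element of [E] comes from a word. *)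
have [u xu] : exists u, normal_closure W (x^-1 * s u).
  pose A := [set x | exists u, normal_closure W (x^-1 * s u)].
  apply: (gen_ind (A := A) genS); last first.
    by move=> y Sy; exists (c y); apply: WN; right; exists y.
  apply: is_subgroupI => [|y z [u yu] [v zv]].
    by exists 1; rewrite homg1 mulg1 invg1; apply: subgroup1 sW.
  exists (u / v); rewrite homgF invgF.
  have : normal_closure W ((y^-1 * s u) / (z^-1 * s v)).
    exact: (subgroupF sW).
  by move=> /(NW _ z^-1); rewrite conjgE !invgM !invgK !mulgA mulgK.
move=> fx; have ux : normal_closure W ((s u)^-1 * x).
  by have := subgroupV sW xu; rewrite invgM invgK.
rewrite -(mulVKg (s u) x); apply: (subgroupM sW) => //; apply: sT.
apply: (kerT _).1; apply: (hE _).1.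
by have := Wker _ xu; rewrite gmulfM homgV fx invg1 mul1g.
Qed.

(** * Integer powers *)

(** The equivalence makes one step serve for both directions. *)
Lemma int_step_ind (P : int -> Prop) :
  P 0%R -> (forall n, P n <-> P (n + 1)%R) -> forall n, P n.
Proof.
move=> P0 PS; elim/int_rect => // n IHn.
  by rewrite -addn1 PoszD; apply: (PS _).1.
by apply: (PS _).2; rewrite -addn1 PoszD GRing.opprD GRing.addrNK.
Qed.

Section IntegerIteration.
Variables (T : Type) (f g : T -> T).
Hypotheses (fK : cancel f g) (gK : cancel g f).

Definition ziter (n : int) (x : T) : T :=
  match n with Posz m => iter m f x | Negz m => iter m.+1 g x end.

Lemma ziterS n x : ziter (n + 1)%R x = f (ziter n x).
Proof.
case: n => [n|[|n]]; rewrite /= ?gK //; last by rewrite subn1.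
by rewrite addn1.
Qed.

Lemma ziterD m n x : ziter (m + n)%R x = ziter m (ziter n x).
Proof.
elim/int_step_ind: m => [|m]; first by rewrite GRing.add0r.
rewrite GRing.addrAC !ziterS; split=> [-> //|]; exact: can_inj fK _ _.
Qed.

End IntegerIteration.

Section IntegerPowers.
Variables (G : groupType) (t : G).

Definition zpow (n : int) : G := ziter ( *%g t) ( *%g t^-1) n 1.

Lemma zpowS n : zpow (n + 1)%R = t * zpow n.
Proof. exact/ziterS/mulVKg. Qed.

Lemma zpowD m n : zpow (m + n)%R = zpow m * zpow n.
Proof.
elim/int_step_ind: m => [|m]; first by rewrite GRing.add0r mul1g.
by rewrite GRing.addrAC !zpowS -mulgA; split=> [-> //|/mulgI].
Qed.

Lemma zpowN n : zpow (- n)%R = (zpow n)^-1.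
Proof. by apply: (mulgI (zpow n)); rewrite -zpowD GRing.subrr mulgV. Qed.

Lemma cyclic_zpow :
  subgroup_gen [set t] = setT -> forall x, exists n, zpow n = x.
Proof.
move=> gent; pose A := [set x | exists n, zpow n = x].
apply: (gen_ind (A := A) gent) => [|_ ->]; last by exists 1%R; exact: mulg1.
apply: is_subgroupI; first by exists 0%R.
by move=> _ _ [m <-] [n <-]; exists (m - n)%R; rewrite zpowD zpowN.
Qed.

End IntegerPowers.

Lemma hom_zpow (G H : groupType) (f : {multiplicative G -> H}) t n :
  f (zpow t n) = zpow (f t) n.
Proof.
elim/int_step_ind: n => [|n]; first exact: homg1.
by rewrite !zpowS gmulfM; split=> [-> //|/mulgI].
Qed.

(** If [zpow t n = 1] with [n] nonzero, then reducing exponents modulo [n] shows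
    that the powers of [t] with exponent below [|n|] exhaust the group. *)
Lemma infinite_cyclic_zpow_eq1 (G : groupType) (t : G) n :
  subgroup_gen [set t] = setT -> infinite_set [set: G] ->
  zpow t n = 1 -> n = 0%R.
Proof.
move=> gent infG tn1; case: (n =P 0%R) => // /eqP n0; case: infG.
have tm (m : int) : zpow t (m * n)%R = 1.
  elim/int_step_ind: m => [|m]; first by rewrite GRing.mul0r.
  by rewrite GRing.mulrDl GRing.mul1r zpowD tn1 mulg1.
apply: (sub_finite_set (B := (fun k : nat => zpow t k) @` `I_`|n|)).
  move=> x _; have [m <-] := cyclic_zpow gent x.
  exists `|(m %% n)%Z|%N.
    by rewrite /= -ltz_nat gez0_abs ?modz_ge0 // ltz_mod.
  by rewrite gez0_abs ?modz_ge0 // [in RHS](divz_eq m n) [in RHS]zpowD tm mul1g.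
by apply: finite_image; exact: finite_II.
Qed.

(** * Semidirect products with the integers *)

Record automorphism (K : groupType) := Automorphism {
  aut_fun :> {multiplicative K -> K};
  aut_inv : {multiplicative K -> K};
  autK : cancel aut_fun aut_inv;
  aut_invK : cancel aut_inv aut_fun }.

(** The pair [(k, n)] stands for [k * t ^ n], where the generator [t] of the
    integers acts on [K] by [t * k * t^-1 = a k].  The product depends on [a],
    so the type must mention [a]. *)
Definition sdprodZ (K : groupType) (a : automorphism K) : Type :=
  (K * int)%type.

HB.instance Definition _ (K : groupType) (a : automorphism K) :=
  Choice.copy (sdprodZ a) (K * int)%type.

Section SemidirectProduct.
Variables (K : groupType) (a : automorphism K).
Local Notation E := (sdprodZ a).
Local Notation pw := (ziter a (aut_inv a)).

Lemma aut_pow_mul n : {morph pw n : x y / x * y}.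
Proof.
move=> x y; elim/int_step_ind: n => // n.
rewrite !(ziterS (@aut_invK _ a)) -gmulfM; split=> [-> //|].
exact: can_inj (@autK _ a) _ _.
Qed.

Definition sdZ_one : E := (1, 0%R).
Definition sdZ_mul (p q : E) : E :=
  (p.1 * pw p.2 q.1, (p.2 + q.2)%R).
Definition sdZ_inv (p : E) : E := (pw (- p.2)%R p.1^-1, (- p.2)%R).

HB.instance Definition _ n := isMultiplicative.Build K K (pw n) (aut_pow_mul n).

Let pw_hom n : {multiplicative K -> K} := pw n.
Let pw1 n : pw n 1 = 1. Proof. exact: (homg1 (pw_hom n)). Qed.
Let pwD m n k : pw (m + n)%R k = pw m (pw n k).
Proof. exact: ziterD (@autK _ a) (@aut_invK _ a) _ _ _. Qed.

Lemma sdZ_mulA : associative sdZ_mul.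
Proof.
move=> [k m] [l n] [x p]; rewrite /sdZ_mul /=.
by rewrite aut_pow_mul pwD mulgA GRing.addrA.
Qed.

Lemma sdZ_mul1 : left_id sdZ_one sdZ_mul.
Proof. by move=> [k m]; rewrite /sdZ_mul /= mul1g GRing.add0r. Qed.

Lemma sdZ_1mul : right_id sdZ_one sdZ_mul.
Proof. by move=> [k m]; rewrite /sdZ_mul /= pw1 mulg1 GRing.addr0. Qed.

Lemma sdZ_mulV : left_inverse sdZ_one sdZ_inv sdZ_mul.
Proof.
move=> [k m]; rewrite /sdZ_mul /sdZ_inv /= -aut_pow_mul mulVg pw1.
by rewrite GRing.addNr.
Qed.

Lemma sdZ_Vmul : right_inverse sdZ_one sdZ_inv sdZ_mul.
Proof.
by move=> [k m]; rewrite /sdZ_mul /sdZ_inv /= -pwD GRing.subrr /= mulgV.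
Qed.

HB.instance Definition _ :=
  isGroup.Build E sdZ_mulA sdZ_mul1 sdZ_1mul sdZ_mulV sdZ_Vmul.

Lemma sdZ_conj (k l : K) m :
  ((k, 0%R) : E) ^ ((l, m) : E) = (pw (- m)%R (k ^ l), 0%R).
Proof.
congr pair => /=; last by rewrite /= GRing.add0r GRing.addNr.
by rewrite !conjgE !aut_pow_mul.
Qed.

Lemma sdprodZ_gen (S : set K) : subgroup_gen S = setT ->
  subgroup_gen ((fun k => (k, 0%R) : E) @` S `|` [set ((1, 1%R) : E)]) = setT.
Proof.
set U := _ `|` _ => genS; rewrite -subTset => -[k n] _.
have sU := subgroup_genP U.
have -> : (k, n) = ((k, 0%R) : E) * ((1, n) : E).
  by congr pair => /=; rewrite ?GRing.add0r ?mulg1.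
apply: (subgroupM sU).
  apply: (gen_ind (A := [set k | subgroup_gen U ((k, 0%R) : E)]) genS).
    apply: is_subgroupI => [|x y xU yU] /=; first exact: subgroup1 sU.
    have -> : (x / y, 0%R) = ((x, 0%R) : E) / ((y, 0%R) : E) by [].
    exact: (subgroupF sU).
  by move=> x Sx; apply: sub_gen_smallest; left; exists x.
elim/int_step_ind: n => [|n]; first exact: subgroup1 sU.
have U1 : subgroup_gen U ((1, 1%R) : E) by apply: sub_gen_smallest; right.
have -> : (1, (n + 1)%R) = ((1, n) : E) * ((1, 1%R) : E).
  by congr pair; rewrite /= pw1 mulg1.
split=> [Un|Un1]; first exact: (subgroupM sU).
by have := subgroupF sU Un1 U1; rewrite mulgK.
Qed.

Variables (G : groupType) (f : {multiplicative K -> G}) (t : G).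
Hypothesis ft : forall k, f (a k) = f k ^ t^-1.

Definition sdprodZ_lift (p : E) : G := f p.1 * zpow t p.2.

Lemma hom_aut_pow n k : f (pw n k) * zpow t n = zpow t n * f k.
Proof.
elim/int_step_ind: n => [|n]; first by rewrite mulg1 mul1g.
rewrite (ziterS (@aut_invK _ a)) ft zpowS conjgE invgK !mulgA mulgVK -!mulgA.
by split=> [-> //|/mulgI].
Qed.

Lemma sdprodZ_lift_mul : {morph sdprodZ_lift : p q / p * q}.
Proof.
move=> [k m] [l n]; rewrite /sdprodZ_lift /= gmulfM zpowD.
by rewrite -!mulgA; congr (_ * _); rewrite !mulgA hom_aut_pow.
Qed.

HB.instance Definition _ :=
  isMultiplicative.Build E G sdprodZ_lift sdprodZ_lift_mul.

Definition sdprodZ_hom : {multiplicative E -> G} := sdprodZ_lift.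

End SemidirectProduct.

(** * Ascending L-presentations *)

Section AscendingPresentations.
Variables (X : choiceType) (R : set (free_group X)).
Variable Phi : set {multiplicative free_group X -> free_group X}.
Local Notation N := (normal_closure (lpres_relators set0 R Phi)).

(** This holds because there are no relators outside [R]: [Phi] maps the set of
    all images of [R] under the monoid into itself. *)
Lemma lpres_stable phi u : Phi phi -> N u -> N (phi u).
Proof.
move=> Pphi; have nN := normal_closureP (lpres_relators set0 R Phi).
apply: (smallest_sub (is_normal_preimage phi nN)).
move=> _ [//|[psi Mpsi [r Rr <-]]].
apply: sub_gen_smallest; right; exists (phi \o psi); last by exists r.
by move=> M [mM PM]; apply: mM.2; [exact: PM | exact: Mpsi].
Qed.

Lemma lpres_relator u : R u -> N u.
Proof.
move=> Ru; apply: sub_gen_smallest; right; exists idfun; last by exists u.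
by move=> M [[]].
Qed.

Lemma lpres_sub_ker (G : groupType) (f : {multiplicative free_group X -> G}) :
  (forall r, R r -> f r = 1) ->
  (forall phi u, Phi phi -> f u = 1 -> f (phi u) = 1) ->
  forall u, N u -> f u = 1.
Proof.
move=> Rf Phif; apply: (smallest_sub (is_normal_ker f)).
move=> _ [//|[psi Mpsi [r Rr <-]]] /=.
pose M := [set phi : {multiplicative free_group X -> free_group X} |
  forall u, f u = 1 -> f (phi u) = 1].
have : M psi; last by apply; apply: Rf.
apply: Mpsi; split; last by move=> phi Pphi u; apply: Phif.
by split=> // phi chi Mphi Mchi u fu; apply/Mphi/Mchi.
Qed.

End AscendingPresentations.

(** * Endomorphisms made inverse to each other by relators *)

Section MutuallyInverseEndomorphisms.
Variable X : finType.
Variables eta tau : {multiplicative free_group X -> free_group X}.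
Local Notation Phi := [set eta; tau].
Local Notation N R := (normal_closure (lpres_relators set0 R Phi)).

Definition inverse_relators : set (free_group X) :=
  range (fun x => (fg_gen x)^-1 * eta (tau (fg_gen x))) `|`
  range (fun x => (fg_gen x)^-1 * tau (eta (fg_gen x))).

Local Notation N0 :=
  (normal_closure_group (lpres_relators set0 inverse_relators Phi)).
Local Notation K := (quotient N0).
Local Notation proj := (quot_proj N0).

Lemma proj_eq1 u : proj u = 1 <-> N inverse_relators u.
Proof. exact: (@quot_proj_ker _ N0). Qed.

Lemma eta_ker u : (N0 : set (free_group X)) u -> (proj \o eta) u = 1.
Proof. by move=> Nu; apply: (proj_eq1 _).2; apply: lpres_stable Nu; left. Qed.

Lemma tau_ker u : (N0 : set (free_group X)) u -> (proj \o tau) u = 1.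
Proof. by move=> Nu; apply: (proj_eq1 _).2; apply: lpres_stable Nu; right. Qed.

Definition eta_quot : {multiplicative K -> K} := quot_hom eta_ker.
Definition tau_quot : {multiplicative K -> K} := quot_hom tau_ker.

Lemma eta_quotE u : eta_quot (proj u) = proj (eta u).
Proof. exact: quot_homE. Qed.

Lemma tau_quotE u : tau_quot (proj u) = proj (tau u).
Proof. exact: quot_homE. Qed.

Lemma eta_quotK : cancel eta_quot tau_quot.
Proof.
apply: (hom_ext (f := tau_quot \o eta_quot) (g := idfun)
  (quot_gen N0 (free_gen X))) => _ [_ [x _ <-] <-].
rewrite -[LHS]/(tau_quot (eta_quot _)) eta_quotE tau_quotE.
apply/esym/eqP/quot_projP.
by apply: lpres_relator; right; exists x.
Qed.

Lemma tau_quotK : cancel tau_quot eta_quot.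
Proof.
apply: (hom_ext (f := eta_quot \o tau_quot) (g := idfun)
  (quot_gen N0 (free_gen X))) => _ [_ [x _ <-] <-].
rewrite -[LHS]/(eta_quot (tau_quot _)) tau_quotE eta_quotE.
apply/esym/eqP/quot_projP.
by apply: lpres_relator; left; exists x.
Qed.

Definition eta_aut : automorphism K := Automorphism eta_quotK tau_quotK.

(** The powers of the automorphism of [K] lift to [F(X)] by iterating [eta] or
    [tau], hence the lift stays among the consequences of any ascending
    L-presentation with the endomorphisms [eta] and [tau]. *)
Lemma aut_pow_proj n u :
  exists2 v, ziter eta_aut (aut_inv eta_aut) n (proj u) = proj v &
    forall R, N R u -> N R v.
Proof.
case: n => n; rewrite /ziter.
  exists (iter n eta u); first by elim: n => //= n ->; exact: eta_quotE.
  by move=> R Nu; elim: n => //= n; apply: lpres_stable; left.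
exists (iter n.+1 tau u).
  by elim: n.+1 => //= m ->; exact: tau_quotE.
by move=> R Nu; elim: n.+1 => //= m; apply: lpres_stable; right.
Qed.

Variables (G : groupType) (g : {multiplicative free_group X -> G}) (t : G).
Hypothesis getaE : forall u, g (eta u) = g u ^ t^-1.
Hypothesis gtauE : forall u, g (tau u) = g u ^ t.

Lemma Phi_ker phi u : Phi phi -> g u = 1 -> g (phi u) = 1.
Proof. by case=> -> gu; rewrite (getaE, gtauE) gu conj1g. Qed.

Lemma inverse_relators_ker u : inverse_relators u -> g u = 1.
Proof.
case=> -[x _ <-]; rewrite gmulfM homgV !(getaE, gtauE).
  by rewrite conjgK mulVg.
by rewrite conjgKV mulVg.
Qed.

(** The two hypotheses on [g u * zpow t n] say that [G] is the semidirect
    product of the range of [g] by an infinite cyclic group generated by [t].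
    The second forces the kernel of [E -> G] into [K], so that normal generators
    of it lift to words over [X]. *)
Lemma ker_ascending_presentation :
  finitely_presented G ->
  (forall y, exists u n, g u * zpow t n = y) ->
  (forall u n, g u * zpow t n = 1 -> n = 0%R) ->
  exists2 R : set (free_group X), finite_set R &
    forall u, g u = 1 <-> N R u.
Proof.
move=> fpG gsurj gfree.
have gN0 u : (N0 : set (free_group X)) u -> g u = 1.
  exact: (lpres_sub_ker inverse_relators_ker Phi_ker).
have g0t k : quot_hom gN0 (eta_aut k) = quot_hom gN0 k ^ t^-1.
  have [u <-] := quot_proj_surj k.
  by rewrite [eta_aut _]eta_quotE !quot_homE getaE.
pose E := sdprodZ eta_aut; pose psi := sdprodZ_hom g0t.
have psiE u n : psi (proj u, n) = g u * zpow t n.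
  by rewrite /psi /= /sdprodZ_lift /= quot_lift_proj.
have [|y|W finW Wker] := @finitely_normally_generated_kernel E G psi _ fpG.
- exists ((fun k => (k, 0%R) : E) @` (proj @` range (@fg_gen X)) `|`
          [set (1, 1%R) : E]).
    rewrite finite_setU; split; last exact: finite_set1.
    by do 3 apply: finite_image; exact: finite_finset.
  by apply: sdprodZ_gen; apply: quot_gen; apply: free_gen.
- by have [u [n <-]] := gsurj y; exists (proj u, n).
pose R := inverse_relators `|` (fun w : E => repr w.1) @` W.
exists R.
  rewrite !finite_setU; split; last exact: finite_image.
  by split; apply: finite_image; exact: finite_finset.
have Ker0 w : psi w = 1 -> w.2 = 0%R /\ g (repr w.1) = 1.
  move: w => [k n]; rewrite -{1}(quot_proj_repr k) psiE => e.
  by have n0 := gfree _ _ e; move: e; rewrite n0 mulg1.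
have WN w : W w -> normal_closure W w by apply: sub_gen_smallest.
have NR_ker : forall u, N R u -> g u = 1.
  apply: lpres_sub_ker Phi_ker => _ [/inverse_relators_ker //|[w Ww <-]].
  by have [_] := Ker0 w ((Wker w).2 (WN w Ww)).
move=> u; split; last exact: NR_ker.
have [sN nN] := normal_closureP (lpres_relators set0 R Phi).
(* The image in [K] of the consequences of [R]. *)
pose P : set E := [set w | w.2 = 0%R /\ exists2 v, w.1 = proj v & N R v].
have nP : is_normal_subgroup P.
  split; first apply: is_subgroupI.
  - by split=> //; exists 1; [rewrite homg1 | exact: subgroup1 sN].
  - move=> [k m] [l n] [/= -> [u1 -> Nu1]] [/= -> [u2 -> Nu2]].
    split=> //; exists (u1 / u2); last exact: (subgroupF sN).
    by rewrite homgF.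
  move=> [k m] [l n] [/= -> [v -> Nv]]; rewrite sdZ_conj.
  have [l' <-] := quot_proj_surj l; rewrite -homgJ.
  have [v' v'E Nv'] := aut_pow_proj (- n)%R (v ^ l').
  by split=> //; exists v'; [exact: v'E | apply: Nv'; exact: nN].
have N0R v : (N0 : set (free_group X)) v -> N R v.
  apply: (smallest_sub (normal_closureP _)) => _ [//|[phi Mphi [r r0 <-]]].
  apply: sub_gen_smallest; right; exists phi => //; exists r => //; by left.
move=> gu; have : normal_closure W (proj u, 0%R).
  by apply/Wker; rewrite psiE gu mulg1.
have WP : W `<=` P.
  move=> w Ww; have [w2 _] := Ker0 w ((Wker w).2 (WN w Ww)); split=> //.
  exists (repr w.1); first by rewrite quot_proj_repr.
  by apply: lpres_relator; right; exists w.
move=> /(smallest_sub nP WP) [_ /= [v /eqP/quot_projP uv Nv]].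
by have := subgroupF sN Nv (N0R _ uv); rewrite invgM invgK mulVKg.
Qed.

End MutuallyInverseEndomorphisms.

Theorem theorem1 (G : groupType) (H : normalSubgroup G) :
  finitely_presented G ->
  finitely_generated H ->
  infinite_cyclic (quotient H) ->
  exists (X : finType) (R : set (free_group X))
    (eta tau : {multiplicative free_group X -> free_group X}),
    finite_set R /\ isomorphic H (lpres_group set0 R [set eta; tau]).
Proof.
move=> fpG /finitely_generated_cover[X [f fsurj]] [[q genq] infQ].
have [t tq] := quot_proj_surj q.
pose g := (val \o f : {multiplicative free_group X -> G}).
have gsurj h : (H : set G) h -> exists u, g u = h.
  move=> Hh; have hH : h \in (H : set G) by apply/mem_set.
  by have [u fu] := fsurj (exist _ h hH); exists u; rewrite /= fu.
have Hg u : (H : set G) (g u) by apply: set_mem; apply: (valP (f u)).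
have gJ s : exists phi : {multiplicative free_group X -> free_group X},
    forall u, g (phi u) = g u ^ s.
  have /choice[w gw] : forall x, exists w, g w = g (fg_gen x) ^ s.
    by move=> x; apply: gsurj; apply: (normalSubgroupP H).2; apply: Hg.
  exists (fg_lift w); pose A := [set u | g (fg_lift w u) = g u ^ s].
  apply: (gen_ind (A := A) (free_gen X)) => [|_ [x _ <-]]; last first.
    by rewrite /A /mkset fg_lift_gen gw.
  apply: is_subgroupI => [|u v]; rewrite /A /mkset ?homg1 ?conj1g //.
  by rewrite !homgF conjMg conjVg => -> ->.
have [eta etaE] := gJ t^-1; have [tau tauE] := gJ t.
have tqn n : quot_proj H (zpow t n) = zpow q n.
  by rewrite -tq; exact: (hom_zpow (quot_proj H)).
have [||R finR kerg] := ker_ascending_presentation etaE tauE fpG.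
- move=> y; have [n tn] := cyclic_zpow genq (quot_proj H y).
  have [u gu] : exists u, g u = y * (zpow t n)^-1.
    apply/gsurj/quot_proj_ker; rewrite homgF /= tqn tn; exact: mulgV.
  by exists u, n; rewrite gu mulgVK.
- move=> u n gtn; apply: (infinite_cyclic_zpow_eq1 genq infQ).
  rewrite -tqn; apply/quot_proj_ker.
  have -> : zpow t n = (g u)^-1 by rewrite -[LHS](mulKg (g u)) gtn mulg1.
  exact: subgroupV (subgroupP H) (Hg u).
exists X, R, eta, tau; split=> //.
apply: (first_isomorphism (f := f)) => // u.
apply: iff_trans (kerg u); split=> [fu | gu].
  by rewrite -[g u]/(val (f u)) fu.
by apply: val_inj; exact: gu.
Qed.
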